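(* For a zero-dimensional frame $L$, the following are equivalent. (1) $L$ is 0-coole. (2) $L$ is $CL$-coole (that is, $D_\sigma CL=D_\infty CL$). (3) $\mathfrak{B}L_\sigma$ is a frame.
   Context: For a frame $L$, $a^*$ denotes the pseudocomplement of $a$, $CL$ the Boolean algebra of complemented elements, and $\mathfrak{B}L=\{x\in L:x=x^{**}\}$ the Booleanization; for $S\subseteq L$, $\mathfrak{B}S=\{s^{**}:s\in S\}$. $L$ is zero-dimensional if every element is a join of elements of $CL$. $L_\sigma$ is the sub-$\sigma$-frame of $L$ generated by $CL$, i.e. the set of countable joins in $L$ of elements of $CL$. $L$ is 0-coole if $\mathfrak{B}L_\sigma=\mathfrak{B}L$. ''$\mathfrak{B}L_\sigma$ is a frame'' refers to its own (induced) order. For a meet-semilattice $A$, a subset $G\subseteq A$ is admissible if $\bigvee G$ exists in $A$ and for each $a\in A$ the join $\bigvee\{a\wedge y:y\in G\}$ exists in $A$ and equals $a\wedge\bigvee G$; a downset $E$ of $A$ is a D-ideal if $\bigvee G\in E$ for each admissible $G\subseteq E$; $D_\infty A$ is the frame of D-ideals under inclusion. $CL$ is identified with the principal downsets in $D_\infty CL$, and $D_\sigma CL$ is the sub-$\sigma$-frame of $D_\infty CL$ generated by $CL$ (closure under finite meets and countable joins, computed in $D_\infty CL$). *)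

(* Defs.v *)
From HB Require Import structures.
From mathcomp Require Import all_boot all_order.
From mathcomp Require Import boolp classical_sets cardinality.

Set Implicit Arguments.
Unset Strict Implicit.
Unset Printing Implicit Defensive.

Import Order.TTheory.
Local Open Scope classical_set_scope.
Local Open Scope order_scope.

(* A subset of a poset, as a poset in its own right (induced order). *)
Definition subposet d (T : porderType d) (A : set T) : Type := set_type A.

Section Subposet.
Context d (T : porderType d) (A : set T).
HB.instance Definition _ := SubChoice.on (@subposet d T A).
HB.instance Definition _ := [SubChoice_isSubPOrder of @subposet d T A by <: with d].
End Subposet.

(* Joins and meets are taken in the poset itself, as suprema and infima, so
   that it makes sense to ask whether an arbitrary poset is a frame.  The cases
   [F = set0] give the least and the greatest element. *)
Definition is_frame d (T : porderType d) : Prop :=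
  [/\ forall F : set T, supremums F !=set0,
      forall F : set T, finite_set F -> infimums F !=set0
    & forall (a : T) (F : set T) (s m : T),
        supremums F s -> infimums [set a; s] m ->
        supremums [set z | exists2 y, F y & infimums [set a; y] z] m].

Definition sub_sigma_frame d (T : porderType d) (S : set T) : Prop :=
  (forall F m, finite_set F -> F `<=` S -> infimums F m -> S m) /\
  (forall F s, countable F -> F `<=` S -> supremums F s -> S s).

Definition sigma_frame_generated d (T : porderType d) (G : set T) : set T :=
  smallest (@sub_sigma_frame d T) G.

Section DIdeals.
Context d (A : meetSemilatticeType d).
Implicit Types (G E : set A).

Definition admissible G : Prop :=
  exists2 s, supremums G s & forall a, supremums [set a `&` y | y in G] (a `&` s).

Definition downset E : Prop := forall x y, x <= y -> E y -> E x.

Definition D_ideal E : Prop :=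
  downset E /\
  forall G s, G `<=` E -> admissible G -> supremums G s -> E s.

(* [set A] is ordered by inclusion. *)
Definition D_infty : Type := subposet [set E : set A | D_ideal E].
HB.instance Definition _ := Order.SubPOrder.on D_infty.

Lemma D_ideal_principal (a : A) : D_ideal [set x | x <= a].
Proof.
split=> [x y xy /= ya|G s GE _ [_ s_least]]; first exact: le_trans xy ya.
by apply: s_least => x Gx; exact: GE.
Qed.

Definition principal (a : A) : D_infty :=
  exist _ [set x | x <= a] (mem_set (D_ideal_principal a)).

Definition D_sigma : set D_infty := sigma_frame_generated (range principal).

End DIdeals.

Section Lattice.
Context d (L : tbDistrLatticeType d).
Implicit Types (x y a : L) (S : set L).

(* In a frame this supremum exists, and it is the greatest element of the set. *)
Definition pcompl a : L := supremum \bot [set x | x `&` a = \bot].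

Definition booleanization : set L := [set x | x = pcompl (pcompl x)].

Definition boolean_image S : set L := [set pcompl (pcompl s) | s in S].

Definition complemented : set L :=
  [set x | exists2 y, x `&` y = \bot & x `|` y = \top].

Definition CL : Type := subposet complemented.
HB.instance Definition _ := Order.SubPOrder.on CL.

Lemma complementedI x y :
  complemented x -> complemented y -> complemented (x `&` y).
Proof.
move=> [x' xx' Ux] [y' yy' Uy]; exists (x' `|` y').
  by rewrite meetUr meetAC xx' meet0x -meetA yy' meetx0 joinxx.
by rewrite joinIl joinA Ux joinCA Uy !(join1x, joinx1) meetxx.
Qed.

Definition CL_meet (u v : CL) : CL :=
  exist _ (val u `&` val v)
    (mem_set (complementedI (set_mem (valP u)) (set_mem (valP v)))).

Lemma CL_lexI (u v w : CL) : (u <= CL_meet v w) = (u <= v) && (u <= w).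
Proof. exact: lexI. Qed.

HB.instance Definition _ := Order.POrder_isMeetSemilattice.Build d CL CL_lexI.

Definition zero_dimensional : Prop :=
  forall x, exists2 S, S `<=` complemented & supremums S x.

Definition L_sigma : set L := sigma_frame_generated complemented.

Definition zero_coole : Prop := boolean_image L_sigma = booleanization.

Definition CL_coole : Prop := @D_sigma d CL = [set: D_infty CL].

End Lattice.

Arguments L_sigma {d} L.
Arguments booleanization {d} L.
Arguments complemented {d} L.

(* Main.v *)
Require Import Defs.
From mathcomp Require Import all_boot all_order.
From mathcomp Require Import boolp classical_sets cardinality.

(** The three conditions are compared through complemented elements.  Write
    [x^**] for the double pseudocomplement and [cone x] for the set of
    complemented elements below [x].

    Over a zero-dimensional frame [L], [cone] is an order isomorphism from the
    Booleanization of [L] onto the frame of D-ideals of [CL]: [cone] reflects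
    the order because elements are joins of complemented ones ([cone_le]); a
    cone of a regular element is closed under the joins that exist in [CL]
    because a nonzero element lies above a nonzero complemented one
    ([D_ideal_cone]); and every D-ideal [E] is the cone of the regular element
    [(\/ E)^**], each complemented [c] below it being the distributive join of
    the elements [c /\ e], [e] in [E] ([D_idealE]).

    Under this isomorphism a join of principal ideals of a family [S] becomes
    [(\/ S)^**] ([supremums_principal]).  In a frame, the sub-sigma-frame
    generated by a set closed under finite meets consists of its countable
    joins ([sigma_frame_generatedE]).  Applied in [L], this shows that the
    elements of the double-negation image of [L_sigma] are the [(\/ S)^**]
    with [S] a countable set of complemented elements; applied in the frame of
    D-ideals, it shows that [D_sigma] consists exactly of their cones.  Hence
    0-coole and [CL]-coole both say that every regular element has this form.

    The Booleanization is a frame ([booleanization_is_frame]), so a 0-coole [L]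
    satisfies the third condition.  Conversely let [x] be regular and suppose
    that the double-negation image of [L_sigma] is complete.  The join [s]
    taken there of the elements below [x] is above [x] by zero-dimensionality;
    it is not larger, because a complemented [c] below [s] and disjoint from
    [x] could be removed from [s], which would leave a smaller upper bound.  So
    [x = s] belongs to the image ([zero_coole_of_complete]). *)

Set Implicit Arguments.
Unset Strict Implicit.
Unset Printing Implicit Defensive.

Import Order.TTheory.
Local Open Scope classical_set_scope.
Local Open Scope order_scope.

(** * Frames and generated sub-sigma-frames *)

Lemma countable_preimage (T U : Type) (f : T -> U) (A : set U) :
  injective f -> countable A -> countable (f @^-1` A).
Proof.
move=> f_inj /countable_injP[g g_inj]; apply/countable_injP; exists (g \o f).
move=> x y /set_mem Afx /set_mem Afy /= gfxy; apply/f_inj/g_inj => //.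
- exact: mem_set.
- exact: mem_set.
Qed.

Section Posets.
Context d (T : porderType d).
Implicit Types (F G S : set T).

Lemma infimums2P (a b z : T) :
  infimums [set a; b] z <->
  [/\ z <= a, z <= b & forall y, y <= a -> y <= b -> y <= z].
Proof.
split=> [[lb_z z_max]|[za zb z_max]].
  split; [by apply: lb_z; left | by apply: lb_z; right |].
  by move=> y ya yb; apply: z_max => w [->|->].
split=> [w [->|->] //|y lb_y].
by apply: z_max; apply: lb_y; [left|right].
Qed.

(** A map with a right adjoint preserves all joins, so residuals of the meet
    operations give the distributive law; joins come from meets as usual. *)
Lemma is_frame_of_residuals :
  (forall F, infimums F !=set0) ->
  (forall a u : T, exists r, forall y z,
     infimums [set a; y] z -> (y <= r <-> z <= u)) ->
  is_frame T.
Proof.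
move=> infs res; split=> [F|F _|a F s m [F_s s_least] /infimums2P[ma ms m_max]].
- have [s [s_low s_great]] := infs (ubound F).
  by exists s; split=> // x Fx; apply: s_great => y; exact.
- exact: infs.
- split=> [z [y Fy /infimums2P[za zy _]]|u u_ub].
    by apply: m_max => //; exact: le_trans zy (F_s _ Fy).
  have [r rP] := res a u; apply/(rP s); first exact/infimums2P.
  apply: s_least => y Fy; have [z yz] := infs [set a; y].
  by apply/(rP _ _ yz)/u_ub; exists y.
Qed.

Lemma finite_infimums_closed (K : set T) (t : T) :
  (forall F, finite_set F -> infimums F !=set0) ->
  (forall x, x <= t) -> K t ->
  (forall x y z, K x -> K y -> infimums [set x; y] z -> K z) ->
  forall F m, finite_set F -> F `<=` K -> infimums F m -> K m.
Proof.
move=> fin_inf t_top Kt K2 F m /finite_seqP[s ->{F}].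
elim: s m => [|x s IHs] m sK [lb_m m_max].
  suff -> : m = t by [].
  by apply/le_anti; rewrite t_top m_max // => y; rewrite /= in_nil.
have [n n_inf] := fin_inf _ (finite_seq s).
have Kn : K n.
  by apply: IHs n_inf => y ys; apply: sK; rewrite /= inE ys orbT.
have Kx : K x by apply: sK; rewrite /= mem_head.
apply: (K2 x n m) => //; apply/infimums2P; split.
- by apply: lb_m; rewrite /= mem_head.
- by apply: n_inf.2 => y ys; apply: lb_m; rewrite /= inE ys orbT.
- move=> y yx yn; apply: m_max => z; rewrite /= inE => /predU1P[->//|zs].
  exact: le_trans yn (n_inf.1 _ zs).
Qed.

Lemma supremums_bigcup F (S : T -> set T) x :
  (forall y, F y -> supremums (S y) y) -> supremums F x ->
  supremums (\bigcup_(y in F) S y) x.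
Proof.
move=> S_sup [F_x x_least]; split=> [z [y Fy Sz]|u u_ub].
  exact: le_trans ((S_sup _ Fy).1 _ Sz) (F_x _ Fy).
by apply: x_least => y Fy; apply: (S_sup _ Fy).2 => z Sz; apply: u_ub; exists y.
Qed.

Definition sub_elt (K : set T) x (Kx : K x) : subposet K :=
  exist _ x (mem_set Kx).

Definition countable_joins G : set T :=
  [set x | exists2 S, countable S /\ S `<=` G & supremums S x].

Lemma countable_joins_sup G F s :
  countable F -> F `<=` countable_joins G -> supremums F s ->
  countable_joins G s.
Proof.
move=> cF FG F_s.
have [y|S SP] := @choice T (set T) (fun y Sy =>
    F y -> [/\ countable Sy, Sy `<=` G & supremums Sy y]).
  have [Fy|nFy] := pselect (F y); last by exists set0.
  by have [Sy [cSy SyG] Sy_y] := FG _ Fy; exists Sy.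
exists (\bigcup_(y in F) S y).
  split; first by apply: bigcup_countable => // y /SP[].
  by move=> z [y Fy Sz]; have [_ SyG _] := SP _ Fy; exact: SyG.
by apply: supremums_bigcup F_s => y /SP[].
Qed.

Lemma countable_infimums2 (a : T) F :
  countable F -> countable [set z | exists2 y, F y & infimums [set a; y] z].
Proof.
pose f y := xget a (infimums [set a; y]).
move=> cF; apply: sub_countable (sub_countable (card_image_le f F) cF).
apply: subset_card_le.
move=> z [y Fy z_inf]; exists y => //.
by apply: (is_subset1_infimums _ z_inf); apply: xgetPex; exists z.
Qed.

(** Countable joins of elements of [G] form a sub-sigma-frame: distributivity
    turns the meet of two of them into a countable join of countable joins of
    binary meets of elements of [G]. *)
Lemma sigma_frame_generatedE G (t : T) :
  is_frame T -> (forall x, x <= t) -> G t ->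
  (forall x y z, G x -> G y -> infimums [set x; y] z -> G z) ->
  sigma_frame_generated G = countable_joins G.
Proof.
move=> [_ fin_inf distr] t_top Gt G2.
have GK : G `<=` countable_joins G.
  move=> x Gx; exists [set x]; last by rewrite supremums1.
  by split=> [|_ -> //]; exact: countable1.
(* The case where one of the two elements is in [G] comes first, since the
   general case distributes one countable join at a time. *)
have K1 a y z : G a -> countable_joins G y -> infimums [set a; y] z ->
    countable_joins G z.
  move=> Ga [S [cS SG] S_y] z_inf.
  exists [set w | exists2 s, S s & infimums [set a; s] w].
    split; first exact: countable_infimums2.
    by move=> w [s Ss]; apply: G2 => //; exact: SG.
  exact: distr z_inf.
have K2 x y z : countable_joins G x -> countable_joins G y ->
    infimums [set x; y] z -> countable_joins G z.
  move=> Kx [S [cS SG] S_y] z_inf.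
  apply: countable_joins_sup (distr _ _ _ _ S_y z_inf).
    exact: countable_infimums2.
  by move=> w [s Ss]; rewrite setUC; apply: K1 => //; exact: SG.
apply/seteqP; split=> [|x [S [cS SG] S_x]].
  apply: smallest_sub => //; split=> [F m|F s].
    exact: (finite_infimums_closed fin_inf t_top (GK _ Gt) K2).
  exact: countable_joins_sup.
move=> K [[_ K_joins] GsubK]; apply: K_joins S_x => //.
exact: subset_trans SG GsubK.
Qed.

End Posets.

(** * The frame of D-ideals of a meet-semilattice *)

Section DIdealFrame.
Context d (A : meetSemilatticeType d).
Implicit Types (E : D_infty A).

Lemma D_inftyP E : D_ideal (val E).
Proof. exact: set_mem (valP E). Qed.

Lemma D_infty_leP E E' : E <= E' <-> val E `<=` val E'.
Proof. by rewrite -subsetEset. Qed.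

(** Testing against principal ideals shows that a meet of D-ideals, known only
    by its universal property, is their intersection. *)
Lemma D_infty_infimums2 E1 E2 E :
  infimums [set E1; E2] E -> val E = val E1 `&` val E2.
Proof.
move=> /infimums2P[/D_infty_leP E_E1 /D_infty_leP E_E2 E_max].
apply/seteqP; split=> [x Ex|x [E1x E2x]].
  by split; [exact: E_E1|exact: E_E2].
have /D_infty_leP: principal x <= E.
  apply: E_max; apply/D_infty_leP => y /= yx.
    exact: (D_inftyP E1).1 yx E1x.
  exact: (D_inftyP E2).1 yx E2x.
by apply; exact: lexx.
Qed.

(** Closure of admissibility under meets is what makes residuals of D-ideals
    D-ideals again. *)
Lemma admissible_meet (a : A) (G : set A) s :
  admissible G -> supremums G s ->
  admissible [set a `&` y | y in G] /\
  supremums [set a `&` y | y in G] (a `&` s).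
Proof.
move=> [s' s'_sup G_distr] s_sup.
rewrite (is_subset1_supremums s_sup s'_sup); split=> //.
exists (a `&` s') => // b; rewrite meetA.
have -> : [set b `&` z | z in [set a `&` y | y in G]] =
          [set (b `&` a) `&` y | y in G].
  by rewrite image_comp; apply: eq_imagel => y _ /=; rewrite meetA.
exact: G_distr.
Qed.

Lemma D_ideal_residual (X U : set A) :
  D_ideal U -> D_ideal [set y | forall x, X x -> U (x `&` y)].
Proof.
move=> [U_down U_join]; split=> [y z yz Uz x Xx|G s GJ G_adm s_sup x Xx].
  by apply: U_down (Uz _ Xx); exact: leI2.
have [xG_adm xs_sup] := admissible_meet x G_adm s_sup.
by apply: U_join xG_adm xs_sup => _ [y Gy <-]; exact: GJ.
Qed.

Lemma D_infty_is_frame : is_frame (D_infty A).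
Proof.
apply: is_frame_of_residuals => [F|E U].
  have I_ideal : D_ideal (\bigcap_(E in F) val E).
    split=> [x y xy Iy E FE|G s GI G_adm s_sup E FE].
      by apply: (D_inftyP E).1 xy _; exact: Iy.
    by apply: (D_inftyP E).2 G_adm s_sup => x /GI; exact.
  exists (sub_elt I_ideal); split=> [E FE|E E_lb].
    by apply/D_infty_leP => x; exact.
  by apply/D_infty_leP => x Ex E' FE'; have /D_infty_leP := E_lb _ FE'; exact.
exists (sub_elt (D_ideal_residual (val E) (D_inftyP U))).
move=> Y Z /D_infty_infimums2 ZE.
split=> /D_infty_leP le_; apply/D_infty_leP => x.
  by rewrite ZE => -[Ex Yx]; rewrite -(meetxx x); exact: le_.
move=> Yx y Ey; apply: le_; rewrite ZE; split.
  by apply: (D_inftyP E).1 Ey; exact: leIl.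
by apply: (D_inftyP Y).1 Yx; exact: leIr.
Qed.

End DIdealFrame.

(** * Pseudocomplements and the Booleanization *)

Section Frame.
Context d (L : tbDistrLatticeType d) (frL : is_frame L).
Implicit Types (x y z a b c : L) (F S : set L).

Notation "x ^**" := (pcompl (pcompl x)) (at level 2, format "x ^**").

Lemma infimums_meet a b : infimums [set a; b] (a `&` b).
Proof.
apply/infimums2P; split=> [||y ya yb]; [exact: leIl|exact: leIr|].
by rewrite lexI ya.
Qed.

(** The default value [\bot] of [supremum] is the join of the empty family, so
    no case has to be excluded. *)
Lemma supremum_supremums F : supremums F (supremum \bot F).
Proof.
rewrite /supremum; case: eqP => [->|_].
  by split=> [x //|x _]; exact: le0x.
by case: frL => sups _ _; exact: xgetPex (sups F).
Qed.

Lemma supremum_leP F x : supremum \bot F <= x <-> F `<=` [set y | y <= x].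
Proof.
have [F_le F_least] := supremum_supremums F.
split=> [Fx y Fy|Fx]; first exact: le_trans (F_le _ Fy) Fx.
exact: F_least.
Qed.

Lemma pcomplP x a : x <= pcompl a <-> x `&` a = \bot.
Proof.
have p_sup : supremums [set x | x `&` a = \bot] (pcompl a).
  exact: supremum_supremums.
split=> [xp|xa]; last exact: p_sup.1.
have [_ _ /(_ a _ _ _ p_sup (infimums_meet _ _)) [_ pa_least]] := frL.
apply/eqP; rewrite -lex0 meetC; apply: le_trans (leI2 (lexx a) xp) _.
apply: pa_least => z [y /= ya z_inf].
by rewrite (is_subset1_infimums z_inf (infimums_meet _ _)) meetC ya.
Qed.

Lemma le_pcompl2 x : x <= x^**.
Proof. by apply/pcomplP; rewrite meetC; apply/pcomplP. Qed.

Lemma pcompl_anti x y : x <= y -> pcompl y <= pcompl x.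
Proof.
move=> xy; apply/pcomplP/eqP; rewrite -lex0.
apply: le_trans (leI2 (lexx _) xy) _.
by rewrite lex0; apply/eqP/pcomplP.
Qed.

Lemma pcompl3 x : pcompl x^** = pcompl x.
Proof. by apply/le_anti; rewrite le_pcompl2 pcompl_anti ?le_pcompl2. Qed.

Lemma pcompl2_le x y : x <= y -> x^** <= y^**.
Proof. by move=> xy; do 2!apply: pcompl_anti. Qed.

Lemma booleanizationP x : booleanization L x <-> x^** <= x.
Proof.
split=> [{2}->//|xx].
by apply/le_anti; rewrite le_pcompl2 xx.
Qed.

Lemma booleanization_pcompl x : booleanization L (pcompl x).
Proof. by rewrite /booleanization /= pcompl3. Qed.

Lemma meet_pcompl2 x a : x `&` a = \bot -> x `&` a^** = \bot.
Proof. by move=> xa; apply/pcomplP; rewrite pcompl3; apply/pcomplP. Qed.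

(** The pseudocomplement of [a] and that of [a^**] agree, so [a] and [a^**] are
    disjoint from the same elements; the two factors can be replaced by their
    double pseudocomplements one after the other. *)
Lemma pcompl2I x y : (x `&` y)^** = x^** `&` y^**.
Proof.
apply/le_anti; rewrite lexI !pcompl2_le ?leIl ?leIr //=.
apply/pcomplP; rewrite meetC meetA meetAC.
apply: meet_pcompl2; rewrite meetAC; apply: meet_pcompl2.
by rewrite -meetA; apply/pcomplP.
Qed.

Lemma complemented_pcompl c c' :
  c `&` c' = \bot -> c `|` c' = \top -> pcompl c = c'.
Proof.
move=> cc' Ucc'; apply/le_anti/andP; split; last first.
  by apply/pcomplP; rewrite meetC.
have pc : pcompl c `&` c = \bot by apply/pcomplP.
by rewrite -[pcompl c]meetx1 -Ucc' meetUr pc join0x leIr.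
Qed.

Lemma complemented_pcompl2 c : complemented L c -> c^** = c.
Proof.
move=> [c' cc' Ucc']; rewrite (complemented_pcompl cc' Ucc').
by apply: complemented_pcompl; rewrite (meetC, joinC).
Qed.

Lemma complementedC c : complemented L c -> complemented L (pcompl c).
Proof.
move=> [c' cc' Ucc']; rewrite (complemented_pcompl cc' Ucc').
by exists c; rewrite (meetC, joinC).
Qed.

Lemma complemented1 : complemented L \top.
Proof. by exists \bot; rewrite ?meetx0 ?joinx0. Qed.

Lemma booleanization_meets F m :
  F `<=` booleanization L -> infimums F m -> booleanization L m.
Proof.
move=> F_reg [m_F m_max]; apply/booleanizationP/m_max => y Fy.
by rewrite (F_reg y Fy); exact: pcompl2_le (m_F _ Fy).
Qed.

(** The residual of [u] by [a] is [(a /\ u^* )^*], which is regular because it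
    is a pseudocomplement. *)
Lemma booleanization_is_frame : is_frame (subposet (booleanization L)).
Proof.
have reg (a : subposet (booleanization L)) : booleanization L (val a).
  exact: set_mem (valP a).
apply: is_frame_of_residuals => [F|a u].
  have [sups _ _] := frL.
  have [m [m_low m_great]] := sups (lbound [set val y | y in F]).
  have m_inf : infimums [set val y | y in F] m.
    by split=> // x Fx; apply: m_great => y; exact.
  have m_reg : booleanization L m.
    by apply: booleanization_meets m_inf => _ [y _ <-].
  exists (sub_elt m_reg); split=> [y Fy|y y_lb].
    by apply: (m_inf.1 (val y)); exists y.
  by apply: m_inf.2 => _ [z Fz <-]; exact: y_lb.
pose r := pcompl (val a `&` pcompl (val u)).
have r_reg : booleanization L r by exact: booleanization_pcompl.
exists (sub_elt r_reg) => y z /infimums2P[za zy z_max].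
have z_val : val z = val a `&` val y.
  have ay_reg : booleanization L (val a `&` val y).
    by rewrite /booleanization /= pcompl2I -(reg a) -(reg y).
  apply/le_anti; rewrite lexI [_ <= _]za [_ <= _]zy /=.
  apply: (z_max (sub_elt ay_reg)); [exact: leIl|exact: leIr].
apply: (@iff_trans _ (val y <= r)); first by [].
apply: (@iff_trans _ (val z <= val u)); last by [].
rewrite z_val (reg u); split=> [/pcomplP yr|/pcomplP zu]; apply/pcomplP.
  by rewrite (meetC (val a)) -meetA.
by rewrite meetA (meetC _ (val a)).
Qed.

Lemma L_sigmaE : L_sigma L = countable_joins (complemented L).
Proof.
apply: (sigma_frame_generatedE frL lex1 complemented1) => x y z Cx Cy.
move=> /is_subset1_infimums/(_ (infimums_meet x y)) ->.
exact: complementedI.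
Qed.

Lemma L_sigma_complemented c : complemented L c -> L_sigma L c.
Proof. by move=> Cc; apply: sub_gen_smallest. Qed.

Lemma L_sigmaI x y : L_sigma L x -> L_sigma L y -> L_sigma L (x `&` y).
Proof.
move=> Sx Sy K KP; have [[K_meets _] _] := KP.
apply: (K_meets _ _ (finite_set2 x y)) (infimums_meet x y).
by move=> _ [->|->]; [exact: Sx|exact: Sy].
Qed.

(** * Regular elements and D-ideals of complemented elements *)

Section ZeroDimensional.
Hypothesis zdL : zero_dimensional L.

Lemma zero_dimensional_le x y :
  (forall c, complemented L c -> c <= x -> c <= y) -> x <= y.
Proof.
move=> xy; have [S SC [S_x x_least]] := zdL x.
by apply: x_least => c Sc; apply: xy; [exact: SC|exact: S_x].
Qed.

Lemma complemented_dense a :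
  (forall c, complemented L c -> c <= a -> c = \bot) -> a = \bot.
Proof.
move=> a0; apply/eqP; rewrite -lex0.
by apply: zero_dimensional_le => c Cc /(a0 _ Cc) ->.
Qed.

Lemma CL_complemented (c : CL L) : complemented L (val c).
Proof. exact: set_mem (valP c). Qed.

Lemma CL_regular (c : CL L) : booleanization L (val c).
Proof. by apply/esym/complemented_pcompl2; exact: CL_complemented. Qed.

Definition cone x : set (CL L) := [set c | val c <= x].

Lemma cone_le x y : cone x `<=` cone y <-> x <= y.
Proof.
split=> [xy|xy c]; last by move=> cx; exact: le_trans cx xy.
by apply: zero_dimensional_le => c Cc; exact: (xy (sub_elt Cc)).
Qed.

(** A complemented [c] below [s] and disjoint from [x] is disjoint from every
    member of [G], so the complement of [c] is an upper bound of [G] in [CL];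
    it is then above [s], hence above [c], which makes [c] zero. *)
Lemma D_ideal_cone x : booleanization L x -> D_ideal (cone x).
Proof.
move=> x_reg; split=> [b c bc cx|G s Gx _ [s_G s_least]].
  exact: (@le_trans _ _ (val c)).
rewrite /cone /= x_reg; apply/pcomplP/complemented_dense => c Cc.
rewrite lexI => /andP[cs cx].
have s_c : s <= sub_elt (complementedC Cc).
  apply: s_least => g Gg; apply/pcomplP/eqP; rewrite -lex0.
  rewrite (_ : \bot = x `&` pcompl x); first exact: leI2 (Gx _ Gg) cx.
  by rewrite meetC; apply/esym/pcomplP.
by rewrite -[c]meetxx; apply/pcomplP; exact: le_trans cs s_c.
Qed.

(** The join of [E] in the Booleanization. *)
Definition join_regular (E : set (CL L)) : L :=
  (supremum \bot [set val c | c in E])^**.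

Lemma join_regular_reg E : booleanization L (join_regular E).
Proof. exact: booleanization_pcompl. Qed.

Lemma join_regular_leP E x :
  booleanization L x -> join_regular E <= x <-> E `<=` cone x.
Proof.
move=> x_reg; split=> [Ex c Ec|Ex].
  apply: le_trans Ex; apply: le_trans (le_pcompl2 _).
  by apply: (supremum_supremums _).1; exists c.
rewrite x_reg; apply: pcompl2_le; apply/supremum_leP => _ [c Ec <-].
exact: Ex.
Qed.

(** An upper bound [u] in [CL] is regular, so [b <= u] amounts to [b] being
    disjoint from [b /\ u^*]; every [e] in [E] is disjoint from [b /\ u^*],
    hence so is [join_regular E], which is above [b]. *)
Lemma supremums_meet_cone E (b : CL L) : cone (join_regular E) b ->
  supremums [set b `&` e | e in E] b.
Proof.
move=> b_le; split=> [_ [e _ <-]|u u_ub]; first exact: leIl.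
have : val b <= (val u)^**; last by rewrite -(CL_regular u).
apply/pcomplP.
have /(le_trans b_le)/pcomplP :
    join_regular E <= pcompl (val b `&` pcompl (val u)).
  apply/join_regular_leP; first exact: booleanization_pcompl.
  move=> e Ee; rewrite /cone /=; apply/pcomplP; rewrite meetA; apply/pcomplP.
  rewrite -(CL_regular u) meetC.
  by apply: (u_ub (b `&` e)); exists e.
by rewrite meetA meetxx.
Qed.

(** Admissibility of the elements [c /\ e] comes from [supremums_meet_cone]
    itself, applied to [a /\ c] in place of [c]. *)
Lemma D_idealE E : D_ideal E -> E = cone (join_regular E).
Proof.
move=> [E_down E_join]; apply/seteqP; split.
  by apply/join_regular_leP; [exact: join_regular_reg|].
move=> c c_le; have c_sup := supremums_meet_cone c_le.
apply: (E_join _ _ _ _ c_sup) => [_ [e Ee <-]|].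
  by apply: E_down Ee; exact: leIr.
exists c => // a; rewrite image_comp.
rewrite [X in supremums X](_ : _ = [set (a `&` c) `&` e | e in E]).
  by apply: supremums_meet_cone; apply: le_trans c_le; exact: (@leIr _ _ c a).
by apply: eq_imagel => e _ /=; rewrite meetA.
Qed.

(** [cone] is an order isomorphism from the Booleanization to the D-ideals, so
    it carries the joins of one to the joins of the other. *)
Lemma supremums_principal (S : set (CL L)) (E : D_infty (CL L)) :
  supremums [set principal c | c in S] E <-> val E = cone (join_regular S).
Proof.
have sup_cone E' : val E' = cone (join_regular S) ->
    supremums [set principal c | c in S] E'.
  move=> E'E; split=> [_ [c Sc <-]|U U_ub].
    apply/D_infty_leP => b /= bc; rewrite E'E.
    apply: (@le_trans _ L (val c)) => //.
    by move: c Sc {bc}; apply/join_regular_leP; first exact: join_regular_reg.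
  have U_ideal := D_inftyP U; apply/D_infty_leP.
  rewrite E'E (D_idealE U_ideal); apply/cone_le/join_regular_leP.
    exact: join_regular_reg.
  rewrite -(D_idealE U_ideal) => c Sc.
  have /D_infty_leP : principal c <= U by apply: U_ub; exists c.
  by apply; exact: lexx.
split=> [E_sup|/sup_cone//].
pose E' : D_infty (CL L) := sub_elt (D_ideal_cone (join_regular_reg S)).
by rewrite (is_subset1_supremums E_sup (sup_cone E' erefl)).
Qed.

(** * The equivalences *)

Lemma D_sigmaE :
  @D_sigma _ (CL L) = countable_joins (range (@principal _ (CL L))).
Proof.
pose t : CL L := sub_elt complemented1.
apply: (@sigma_frame_generatedE _ _ _ (principal t)) =>
  [|E||_ _ E [b _ <-] [c _ <-]].
- exact: D_infty_is_frame.
- by apply/D_infty_leP => c _; exact: (lex1 (val c)).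
- by exists t.
move=> /D_infty_infimums2 EE; exists (b `&` c) => //; apply: val_inj.
rewrite EE; apply/seteqP; split=> [x /=|x [/= xb xc]]; last by rewrite lexI xb.
by rewrite lexI => /andP[].
Qed.

Lemma D_sigmaP E :
  D_sigma E <-> exists2 S, countable S & val E = cone (join_regular S).
Proof.
rewrite D_sigmaE.
split=> [[P [cP Pprinc] P_E]|[S cS /supremums_principal E_sup]].
  pose S := (@principal _ (CL L)) @^-1` P.
  have PE : P = [set principal c | c in S].
    apply/seteqP; split=> [Q PQ|_ [c Sc <-] //].
    by have [c _ cQ] := Pprinc _ PQ; exists c => //; rewrite /S /= cQ.
  exists S; last by apply/supremums_principal; rewrite -PE.
  apply: countable_preimage cP => b c /(congr1 val) /= bc.
  have b_le_c : [set x | x <= c] b by rewrite -bc; exact: lexx.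
  have c_le_b : [set x | x <= b] c by rewrite bc; exact: lexx.
  by apply/le_anti; rewrite [_ <= _]b_le_c.
exists [set principal c | c in S] => //; split; last first.
  by move=> _ [c _ <-]; exists c.
exact: sub_countable (card_image_le _ _) cS.
Qed.

Lemma boolean_L_sigmaP x : boolean_image (L_sigma L) x <->
  exists2 S, countable S & x = join_regular S.
Proof.
rewrite L_sigmaE; split=> [[s [S [cS SC] S_s] <-]|[S cS ->]].
  pose S' : set (CL L) := val @^-1` S.
  have SE : S = [set val c | c in S'].
    apply/seteqP; split=> [c Sc|_ [c Sc <-] //].
    by exists (sub_elt (SC _ Sc)).
  exists S'; first exact: countable_preimage val_inj cS.
  rewrite /join_regular -SE.
  by rewrite (is_subset1_supremums S_s (supremum_supremums S)).
exists (supremum \bot [set val c | c in S]) => //.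
exists [set val c | c in S]; last exact: supremum_supremums.
split; first exact: sub_countable (card_image_le _ _) cS.
by move=> _ [c _ <-]; exact: CL_complemented.
Qed.

Lemma boolean_L_sigma_sub : boolean_image (L_sigma L) `<=` booleanization L.
Proof. by move=> _ [s _ <-]; exact: booleanization_pcompl. Qed.

Lemma zero_cooleP : zero_coole L <-> CL_coole L.
Proof.
split=> [zc|cc].
  apply/seteqP; split=> // E _; apply/D_sigmaP.
  have : booleanization L (join_regular (val E)) by exact: join_regular_reg.
  rewrite -zc => /boolean_L_sigmaP[S cS ES]; exists S => //.
  by rewrite -ES; apply: D_idealE; exact: D_inftyP.
apply/seteqP; split; first exact: boolean_L_sigma_sub.
move=> x x_reg; apply/boolean_L_sigmaP.
pose E : D_infty (CL L) := sub_elt (D_ideal_cone x_reg).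
have : D_sigma E by move: cc; rewrite /CL_coole => ->.
move=> /D_sigmaP[S cS /= ES]; exists S => //.
by apply/le_anti/andP; split; apply/cone_le; rewrite ES.
Qed.

(** The join [s] of all members of the image below [x] cannot exceed [x]:
    removing from it a complemented element disjoint from [x] stays inside the
    image and leaves an upper bound of the same elements. *)
Lemma zero_coole_of_complete :
  (forall F : set (subposet (boolean_image (L_sigma L))), supremums F !=set0) ->
  zero_coole L.
Proof.
move=> sups; apply/seteqP; split; first exact: boolean_L_sigma_sub.
move=> x x_reg.
pose BS := boolean_image (L_sigma L).
have [s [s_ub s_least]] := sups [set y : subposet BS | val y <= x].
have [t t_sigma ts] := set_mem (valP s).
suff -> : x = val s by rewrite -ts; exists t.
have cone_s : cone x `<=` cone (val s).
  move=> c cx; have BSc : BS (val c).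
    exists (val c).
      by apply: L_sigma_complemented; exact: CL_complemented.
    exact/esym/CL_regular.
  exact: (s_ub (sub_elt BSc)).
apply/le_anti; rewrite (_ : x <= val s) /=; last exact/cone_le.
rewrite x_reg; apply/pcomplP/complemented_dense => c Cc.
rewrite lexI => /andP[cs cx].
(* This is [s] with [c] removed, again in the image of [L_sigma]. *)
have BSu : BS (t `&` pcompl c)^**.
  exists (t `&` pcompl c) => //; apply: L_sigmaI => //.
  by apply: L_sigma_complemented; exact: complementedC.
have s_u : s <= sub_elt BSu.
  apply: s_least => y yx; have ys := s_ub _ yx.
  have yc : val y <= pcompl c.
    by apply: le_trans yx _; apply/pcomplP; rewrite meetC; apply/pcomplP.
  have : val y <= (t `&` pcompl c)^**; last by [].
  by rewrite pcompl2I ts pcompl3 lexI yc andbT.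
rewrite -[c]meetxx; apply/pcomplP.
have : val s <= (t `&` pcompl c)^** by [].
by move/(le_trans cs)/le_trans; apply; rewrite pcompl2I pcompl3 leIr.
Qed.

End ZeroDimensional.

End Frame.

Theorem proposition6p22 (d : Order.disp_t) (L : tbDistrLatticeType d) :
  is_frame L -> zero_dimensional L ->
  (zero_coole L <-> CL_coole L) /\
  (CL_coole L <-> is_frame (subposet (boolean_image (L_sigma L)))).
Proof.
move=> frL zdL; have zc := zero_cooleP frL zdL; split=> //.
split=> [/zc zcL|[sups _ _]].
  by rewrite zcL; exact: booleanization_is_frame.
by apply/zc/zero_coole_of_complete.
Qed.
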